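(* Let $2<n\le l<\omega$. Then Vaught's theorem fails for any first-order definable extension of $L_n$ using $l$ variables: there is a countable, complete and atomic theory in that logic which has no atomic model (equivalently, the type consisting of the co-atoms of its Tarski–Lindenbaum algebra is realized in every model).
   Context: $L_n$ is first-order logic restricted to the first $n$ variables. A first-order definable extension $\mathcal L_l$ of $L_n$ using $l$ variables is obtained by adding new connectives of arity at most $n$, each defined by a first-order formula (in the same relational signature) using at most $l$ variables, with free variables among the first $n$; formulas are formed inductively, models are the same as those of $L_n$, and a new connective is interpreted in a model $\mathcal M$ through the set of $n$-ary assignments satisfying its defining formula in $\mathcal M$. A theory $T$ is atomic if its Tarski–Lindenbaum algebra is atomic as a Boolean algebra, and complete if that algebra is simple. An atomic model is one in which every satisfied assignment satisfies some formula whose class is an atom (i.e. the type of co-atoms is omitted). *)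

(* Defs.v *)
From HB Require Import structures.
From mathcomp Require Import all_boot all_order.
From mathcomp Require Import boolp classical_sets cardinality.

Set Implicit Arguments.
Unset Strict Implicit.
Unset Printing Implicit Defensive.

Import Order.TTheory.
Local Open Scope classical_set_scope.
Local Open Scope quotient_scope.

Record signature := Signature {
  symbol :> Type;
  arity : symbol -> nat }.

Record structure (S : signature) := Structure {
  domain :> Type;
  domain_inhabited : inhabited domain;
  interp : forall r : S, ('I_(arity r) -> domain) -> Prop }.

(* First-order logic with equality over the variables v_0, ..., v_(m-1). *)
Inductive fo_formula (S : signature) (m : nat) : Type :=
| FoBot
| FoEq (i j : 'I_m)
| FoRel (r : S) (x : 'I_(arity r) -> 'I_m)
| FoNot (f : fo_formula S m)
| FoAnd (f g : fo_formula S m)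
| FoEx (i : 'I_m) (f : fo_formula S m).

Fixpoint fo_free S m (i : 'I_m) (f : fo_formula S m) : bool :=
  match f with
  | FoBot => false
  | FoEq j k => (i == j) || (i == k)
  | FoRel r x => [exists a, x a == i]
  | FoNot f => fo_free i f
  | FoAnd f g => fo_free i f || fo_free i g
  | FoEx j f => (i != j) && fo_free i f
  end.

Fixpoint fo_sat S m (M : structure S) (f : fo_formula S m) (s : 'I_m -> M)
    : Prop :=
  match f with
  | FoBot => False
  | FoEq i j => s i = s j
  | FoRel r x => interp (s \o x)
  | FoNot f => ~ fo_sat f s
  | FoAnd f g => fo_sat f s /\ fo_sat g s
  | FoEx i f => exists a : M, fo_sat f [eta s with i |-> a]
  end.

(* S together with k fresh n-ary symbols, standing for the k arguments of a
   connective: in a structure, an argument denotes a set of n-ary assignments. *)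
Definition expand_sig (S : signature) (n k : nat) : signature :=
  @Signature (S + 'I_k)%type
    (fun r => match r with inl r => arity r | inr _ => n end).

Definition expand_structure S n k (M : structure S)
    (P : 'I_k -> ('I_n -> M) -> Prop) : structure (expand_sig S n k) :=
  @Structure (expand_sig S n k) M (domain_inhabited M)
    (fun r => match r return ('I_(@arity (expand_sig S n k) r) -> M) -> Prop with
              | inl r => @interp S M r
              | inr j => P j
              end).

(* The defining formula of a connective may use the symbols of S as well as
   its arguments, and at most the variables v_0, ..., v_(l-1). *)
Record extension (S : signature) (n l : nat) := Extension {
  connective : Type;
  rank : connective -> nat;
  rank_le : forall c, rank c <= n;
  defining : forall c, fo_formula (expand_sig S n (rank c)) l;
  defining_free : forall c (i : 'I_l), fo_free i (defining c) -> i < n }.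

Section Logic.
Variables (S : signature) (n l : nat) (E : extension S n l).

Inductive formula : Type :=
| Bot
| Eq (i j : 'I_n)
| Rel (r : S) (x : 'I_(arity r) -> 'I_n)
| Not (f : formula)
| And (f g : formula)
| Ex (i : 'I_n) (f : formula)
| Conn (c : connective E) (args : 'I_(rank c) -> formula).

HB.instance Definition _ := gen_eqMixin formula.
HB.instance Definition _ := gen_choiceMixin formula.

Definition Top := Not Bot.
Definition Or f g := Not (And (Not f) (Not g)).

(* Arguments only contribute to c(f_0, ...) through n-ary atoms of the defining
   formula of c, hence the free variables of the latter. *)
Fixpoint free (i : 'I_n) (f : formula) : bool :=
  match f with
  | Bot => false
  | Eq j k => (i == j) || (i == k)
  | Rel r x => [exists a, x a == i]
  | Not f => free i f
  | And f g => free i f || free i g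
  | Ex j f => (i != j) && free i f
  | Conn c _ => [exists j : 'I_l, (j == i :> nat) && fo_free j (defining c)]
  end.

Definition sentence : set formula := [set f | forall i, ~~ free i f].

(* As the free variables of the defining formula are among the first n, its
   truth value does not depend on the l-ary assignment t extending s. *)
Fixpoint sat (M : structure S) (f : formula) (s : 'I_n -> M) : Prop :=
  match f with
  | Bot => False
  | Eq i j => s i = s j
  | Rel r x => interp (s \o x)
  | Not f => ~ sat f s
  | And f g => sat f s /\ sat g s
  | Ex i f => exists a : M, sat f [eta s with i |-> a]
  | Conn c args => exists t : 'I_l -> M,
      (forall (i : 'I_n) (j : 'I_l), i = j :> nat -> t j = s i) /\
      @fo_sat _ _ (expand_structure (fun k => @sat M (args k))) (defining c) t
  end.

Definition model (M : structure S) (T : set formula) : Prop :=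
  forall f, T f -> forall s : 'I_n -> M, sat f s.

Definition is_theory (T : set formula) : Prop := T `<=` sentence.

Section TarskiLindenbaum.
Variable T : set formula.

(* T |= f <-> g *)
Definition tl_equiv (f g : formula) : bool :=
  `[< forall M : structure S, model M T ->
      forall s : 'I_n -> M, sat f s <-> sat g s >].

Lemma tl_equiv_refl : reflexive tl_equiv.
Proof. by move=> f; apply/asboolP. Qed.

Lemma tl_equiv_sym : symmetric tl_equiv.
Proof.
by move=> f g; apply/asboolP/asboolP => fg M MT s; apply: iff_sym; apply: fg.
Qed.

Lemma tl_equiv_trans : transitive tl_equiv.
Proof.
move=> g f h /asboolP fg /asboolP gh; apply/asboolP => M MT s.
exact: iff_trans (fg M MT s) (gh M MT s).
Qed.

Canonical tl_equiv_rel :=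
  EquivRel tl_equiv tl_equiv_refl tl_equiv_sym tl_equiv_trans.

Definition TL := {eq_quot tl_equiv_rel}.
HB.instance Definition _ := Choice.copy TL {eq_quot tl_equiv_rel}.
HB.instance Definition _ :=
  EqQuotient.copy TL {eq_quot tl_equiv_rel}.

Definition tl_class (f : formula) : TL := \pi_TL f.

Lemma tl_classP f g : tl_class f = tl_class g <->
  (forall M : structure S, model M T -> forall s : 'I_n -> M, sat f s <-> sat g s).
Proof.
split=> [/eqP|fg]; first by rewrite eqmodE => /asboolP.
by apply/eqP; rewrite eqmodE; apply/asboolP.
Qed.

Lemma tl_reprK x : tl_class (repr x) = x.
Proof. exact: reprK. Qed.

Lemma sat_repr (M : structure S) (s : 'I_n -> M) f : model M T ->
  sat (repr (tl_class f)) s <-> sat f s.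
Proof. by move=> MT; apply: (tl_classP _ _).1 => //; rewrite tl_reprK. Qed.

Definition tl_bot : TL := tl_class Bot.
Definition tl_top : TL := tl_class Top.
Definition tl_not (x : TL) : TL := tl_class (Not (repr x)).
Definition tl_and (x y : TL) : TL := tl_class (And (repr x) (repr y)).
Definition tl_or (x y : TL) : TL := tl_class (Or (repr x) (repr y)).
Definition tl_eq (i j : 'I_n) : TL := tl_class (Eq i j).
Definition tl_ex (i : 'I_n) (x : TL) : TL := tl_class (Ex i (repr x)).
Definition tl_conn (c : connective E) (x : 'I_(rank c) -> TL) : TL :=
  tl_class (Conn (fun k => repr (x k))).

Lemma tl_notE f : tl_not (tl_class f) = tl_class (Not f).
Proof. by apply/tl_classP => M MT s /=; rewrite (propext (sat_repr _ _ MT)). Qed.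

Lemma tl_andE f g : tl_and (tl_class f) (tl_class g) = tl_class (And f g).
Proof. by apply/tl_classP => M MT s /=; rewrite !(propext (sat_repr _ _ MT)). Qed.

Lemma tl_orE f g : tl_or (tl_class f) (tl_class g) = tl_class (Or f g).
Proof. by apply/tl_classP => M MT s /=; rewrite !(propext (sat_repr _ _ MT)). Qed.

Lemma tl_exE i f : tl_ex i (tl_class f) = tl_class (Ex i f).
Proof.
apply/tl_classP => M MT s /=.
by split=> -[a fa]; exists a; apply/(sat_repr _ _ MT).
Qed.

Lemma tl_connE c (f : 'I_(rank c) -> formula) :
  tl_conn (fun k => tl_class (f k)) = tl_class (Conn f).
Proof.
apply/tl_classP => M MT s /=.
suff -> : (fun k => @sat M (repr (tl_class (f k)))) = (fun k => @sat M (f k)).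
  by [].
by apply/funext => k; apply/funext => u; apply/propext; exact: sat_repr.
Qed.

Let tl_le x y := tl_and x y == x.
Let tl_lt x y := (y != x) && tl_le x y.

Local Ltac tl_solve := intros;
  repeat match goal with
  | x : TL |- _ => rewrite -(tl_reprK x); move: (repr x) => {}x
  end;
  rewrite ?(tl_notE, tl_andE, tl_orE);
  apply/tl_classP => ? _ ? /=;
  repeat match goal with
  | |- context [sat ?f ?s] => case: (EM (sat f s)); move: (sat f s) => ?
  end; tauto.

Fact tl_andC : commutative tl_and. Proof. by rewrite /commutative; tl_solve. Qed.
Fact tl_orC : commutative tl_or. Proof. by rewrite /commutative; tl_solve. Qed.
Fact tl_andA : associative tl_and. Proof. by rewrite /associative; tl_solve. Qed.
Fact tl_orA : associative tl_or. Proof. by rewrite /associative; tl_solve. Qed.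
Fact tl_orKI y x : tl_and x (tl_or x y) = x. Proof. by tl_solve. Qed.
Fact tl_andKU y x : tl_or x (tl_and x y) = x. Proof. by tl_solve. Qed.
Fact tl_andUl : left_distributive tl_and tl_or.
Proof. by rewrite /left_distributive; tl_solve. Qed.
Fact tl_andxx : idempotent_op tl_and.
Proof. by rewrite /idempotent_op; tl_solve. Qed.
Fact tl_and_bot x : tl_and tl_bot x = tl_bot.
Proof. by rewrite /tl_bot; tl_solve. Qed.
Fact tl_and_top x : tl_and x tl_top = x.
Proof. by rewrite /tl_top; tl_solve. Qed.
Fact tl_orN x : tl_or x (tl_not x) = tl_top.
Proof. by rewrite /tl_top; tl_solve. Qed.
Fact tl_andN x : tl_and x (tl_not x) = tl_bot.
Proof. by rewrite /tl_bot; tl_solve. Qed.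

Fact tl_display : Order.disp_t. Proof. exact: Order.Disp tt tt. Qed.

HB.instance Definition _ :=
  @Order.isMeetJoinDistrLattice.Build tl_display TL tl_le tl_lt tl_and tl_or
    (fun _ _ => erefl) (fun _ _ => erefl)
    tl_andC tl_orC tl_andA tl_orA tl_orKI tl_andKU tl_andUl tl_andxx.

HB.instance Definition _ :=
  @Order.hasBottom.Build tl_display TL tl_bot
    (fun x => introT eqP (tl_and_bot x)).

HB.instance Definition _ :=
  @Order.hasTop.Build tl_display TL tl_top
    (fun x => introT eqP (tl_and_top x)).

HB.instance Definition _ :=
  @Order.TBDistrLattice_hasComplement.Build tl_display TL tl_not tl_orN tl_andN.

(* Congruences of the full Tarski-Lindenbaum algebra, which carries the
   quantifiers and the new connectives as operations; the remaining operations
   \bot, \top and tl_eq are constants, and joins come from meets and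
   complements. *)
Record congruence (R : TL -> TL -> Prop) : Prop := Congruence {
  cong_refl : forall x, R x x;
  cong_sym : forall x y, R x y -> R y x;
  cong_trans : forall x y z, R x y -> R y z -> R x z;
  cong_not : forall x x', R x x' -> R (~` x)%O (~` x')%O;
  cong_and : forall x x' y y',
    R x x' -> R y y' -> R (x `&` y)%O (x' `&` y')%O;
  cong_ex : forall i x x', R x x' -> R (tl_ex i x) (tl_ex i x');
  cong_conn : forall c (x x' : 'I_(rank c) -> TL),
    (forall k, R (x k) (x' k)) -> R (tl_conn x) (tl_conn x') }.

Definition simple_algebra : Prop :=
  (exists x y : TL, x <> y) /\
  forall R, congruence R ->
    (forall x y, R x y -> x = y) \/ (forall x y, R x y).

End TarskiLindenbaum.
End Logic.

Definition atom d (B : tbPOrderType d) (a : B) : Prop :=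
  a <> \bot%O /\ forall x : B, (x <= a)%O -> x = \bot%O \/ x = a.

Definition coatom d (B : tbPOrderType d) (a : B) : Prop :=
  a <> \top%O /\ forall x : B, (a <= x)%O -> x = \top%O \/ x = a.

Definition atomic_algebra d (B : ctbDistrLatticeType d) : Prop :=
  forall x : B, x <> \bot%O -> exists a : B, atom a /\ (a <= x)%O.

Section Theories.
Variables (S : signature) (n l : nat) (E : extension S n l).
Variable T : set (formula E).

Definition atomic_theory : Prop := atomic_algebra (TL T).

Definition complete_theory : Prop := simple_algebra T.

Definition coatom_type : set (formula E) :=
  [set f | coatom (tl_class T f)].

Definition realizes (M : structure S) (G : set (formula E)) : Prop :=
  exists s : 'I_n -> M, forall f, G f -> sat f s.

Definition atomic_model (M : structure S) : Prop :=
  model M T /\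
  forall s : 'I_n -> M, exists f : formula E, atom (tl_class T f) /\ sat f s.

End Theories.

(* Main.v *)
Require Import Defs.
From mathcomp Require Import all_boot all_order.
From mathcomp Require Import boolp classical_sets cardinality.

(* The theory is that of an infinite generic edge-coloured structure [generic l].
   Each pair of distinct vertices carries a blur u < 2l+1 and either nothing more or
   a level k and a colour c < l; only the labels (u, c, k) of the second kind are
   named, by binary symbols. In a triangle of constant blur all levels agree (having
   none counts as a level) and the three edges are not all labelled with the same
   colour; other triangles are unconstrained. There are enough blurs to
   extend any configuration of l vertices, and enough colours to replace unnamed
   levels by large named ones, so a formula with l variables that mentions only levels
   below K does not see which edges of level >= K are named. Hence the atoms are the
   types of the tuples all of whose edges are named. A model in which every tuple
   satisfies an atom would be an infinite complete graph whose edges are coloured by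
   the finitely many pairs (u, c) without monochromatic triangle, against Ramsey's
   theorem. *)

Set Implicit Arguments.
Unset Strict Implicit.
Unset Printing Implicit Defensive.

Import Order.Theory.

(** * Formulas up to a countable code *)

Section Codes.

Local Notation tree := (GenTree.tree nat).
Local Notation leaf i := (GenTree.Leaf (nat_of_ord i)).

Lemma map_enum_inj k (A : Type) (F G : 'I_k -> A) :
  [seq F i | i <- enum 'I_k] = [seq G i | i <- enum 'I_k] -> F =1 G.
Proof. by move=> FG i; apply: (eq_in_map F G (enum 'I_k)).2; rewrite ?mem_enum. Qed.

Section FirstOrder.
Variables (S : signature) (symbol_code : S -> nat).
Hypothesis symbol_code_inj : injective symbol_code.

Fixpoint fo_code m (f : fo_formula S m) : tree :=
  match f with
  | FoBot => GenTree.Node 0 [::]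
  | FoEq i j => GenTree.Node 1 [:: leaf i; leaf j]
  | FoRel r x =>
    GenTree.Node 2 (GenTree.Leaf (symbol_code r) ::
                    [seq leaf (x a) | a <- enum 'I_(arity r)])
  | FoNot f => GenTree.Node 3 [:: fo_code f]
  | FoAnd f g => GenTree.Node 4 [:: fo_code f; fo_code g]
  | FoEx i f => GenTree.Node 5 [:: leaf i; fo_code f]
  end.

Lemma fo_code_inj m : injective (@fo_code m).
Proof.
elim=> [|i j|r x|f IHf|f IHf g IHg|i f IHf] [|i' j'|r' x'|f'|f' g'|i' f'] //=.
- by case=> /val_inj -> /val_inj ->.
- case=> /symbol_code_inj rr'; case: r' / rr' x' => x' /map_enum_inj xx'.
  by congr FoRel; apply/funext => a; apply: val_inj; case: (xx' a).
- by case=> /IHf ->.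
- by case=> /IHf -> /IHg ->.
- by case=> /val_inj -> /IHf ->.
Qed.
End FirstOrder.

Variables (S : signature) (n l : nat) (E : extension S n l).
Variables (symbol_code : S -> nat).
Hypothesis symbol_code_inj : injective symbol_code.

Definition expand_code k (r : expand_sig S n k) : nat :=
  match r with inl r => (symbol_code r).*2.+1 | inr j => j.*2 end.

Lemma expand_code_inj k : injective (@expand_code k).
Proof.
move=> [r|j] [r'|j'] /=.
- by case=> /double_inj/symbol_code_inj ->.
- by move/(congr1 odd); rewrite /= !odd_double.
- by move/(congr1 odd); rewrite /= !odd_double.
- by move/double_inj/val_inj ->.
Qed.

(** The connectives may form an uncountable type, so [Conn] records only the rank and the code of
    the defining formula. [code] need not be injective, but it determines the meaning of a
    formula. *)
Fixpoint code (f : formula E) : tree :=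
  match f with
  | Bot => GenTree.Node 0 [::]
  | Eq i j => GenTree.Node 1 [:: leaf i; leaf j]
  | Rel r x =>
    GenTree.Node 2 (GenTree.Leaf (symbol_code r) ::
                    [seq leaf (x a) | a <- enum 'I_(arity r)])
  | Not f => GenTree.Node 3 [:: code f]
  | And f g => GenTree.Node 4 [:: code f; code g]
  | Ex i f => GenTree.Node 5 [:: leaf i; code f]
  | Conn c args =>
    GenTree.Node 6 [:: GenTree.Leaf (rank c), fo_code (@expand_code _) (defining c)
                    & [seq code (args k) | k <- enum 'I_(rank c)]]
  end.

(** The [Conn] clause of [sat] with the rank and the defining formula as parameters, for transport
    along an equality of ranks. *)
Definition conn_sat k (d : fo_formula (expand_sig S n k) l) (N : structure S)
    (P : 'I_k -> ('I_n -> N) -> Prop) (s : 'I_n -> N) : Prop :=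
  exists t : 'I_l -> N,
    (forall (i : 'I_n) (j : 'I_l), i = j :> nat -> t j = s i) /\
    @fo_sat _ _ (expand_structure P) d t.

Lemma code_conn (A : Type) k k' (d : fo_formula (expand_sig S n k) l)
    (d' : fo_formula (expand_sig S n k') l) (a : 'I_k -> A) (a' : 'I_k' -> A) :
  k = k' -> fo_code (@expand_code _) d = fo_code (@expand_code _) d' ->
  [seq a i | i <- enum 'I_k] = [seq a' i | i <- enum 'I_k'] ->
  exists kk' : k = k',
    d' = ecast k (fo_formula (expand_sig S n k) l) kk' d /\
    forall i, a' (cast_ord kk' i) = a i.
Proof.
move=> kk'; case: k' / kk' d' a' => d' a' dd' /map_enum_inj aa'.
exists erefl; split=> [|i]; last by rewrite cast_ord_id -aa'.
by apply/esym/(fo_code_inj (@expand_code_inj _) dd').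
Qed.

Lemma code_equiv (f g : formula E) : code f = code g ->
  (forall (N : structure S) (s : 'I_n -> N), sat f s <-> sat g s) /\
  forall i, free i f = free i g.
Proof.
elim: f g => [|i j|r x|f IHf|f IHf g IHg|i f IHf|c args IH]
  [|i' j'|r' x'|f'|f' g'|i' f'|c' args'] //=.
- by case=> /val_inj -> /val_inj ->.
- case=> /symbol_code_inj rr'; case: r' / rr' x' => x' /map_enum_inj xx'.
  have -> // : x = x' by apply/funext => a; apply: val_inj; case: (xx' a).
- case=> /IHf[ff' fr]; split=> // N s.
  by have := ff' N s; tauto.
- case=> /IHf[ff' fr] /IHg[gg' gr]; split=> [N s|i]; last by rewrite fr gr.
  by have := ff' N s; have := gg' N s; tauto.
- case=> /val_inj -> /IHf[ff' fr]; split=> [N s|j]; last by rewrite fr.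
  by split=> -[a /ff' ?]; exists a.
- case=> rr' dd' aa'.
  have [kk' [def_d' a'E]] := code_conn rr' dd' aa'.
  have argsE N k : @sat _ _ _ _ N (args k) = @sat _ _ _ _ N (args' (cast_ord kk' k)).
    apply/funext => s; apply/propext.
    by have [ff' _] := IH k _ (esym (a'E k)); exact: ff'.
  split=> [N s|i].
    suff E' : forall P P', (forall k, P k = P' (cast_ord kk' k)) ->
        conn_sat (defining c) P s <-> @conn_sat _ (defining c') N P' s.
      exact: (E' (fun k => @sat _ _ _ _ N (args k)) _ (argsE N)).
    rewrite def_d'; case: _ / kk' {def_d' a'E argsE} => P P' PP'.
    have -> // : P = P' by apply/funext => k; rewrite PP' cast_ord_id.
  apply: eq_existsb => j; congr (_ && _).
  by rewrite def_d'; case: _ / kk' {def_d' a'E argsE}.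
Qed.

End Codes.

(** * Well-founded labelled trees *)

Section Model.
Variable l : nat.

Definition label := ('I_l.*2.+1 * option (nat * 'I_l))%type.
Definition level (L : label) : option nat := omap fst L.2.

Definition compatible (L1 L2 L3 : label) : Prop :=
  L1.1 = L2.1 -> L2.1 = L3.1 ->
  [/\ level L1 = level L2, level L2 = level L3 &
      L1.2 = L2.2 -> L2.2 = L3.2 -> L1.2 = None].

(* A vertex is the list of the at most l older vertices it was created over,
   together with the labels prescribed on the edges to them. *)
Inductive tree : Type :=
| Leaf
| Node (f : 'I_l -> tree) (g : 'I_l -> label).

(** Repeated entries of [f] pad smaller sets of vertices; in a well-formed tree [g] agrees on
    repetitions, so the picked [b] does not matter. *)
Definition child_label (x y : tree) : option label :=
  if x is Node f g then omap g [pick b | `[< f b = y >]] else None.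

Definition used_blurs (x : tree) : {set 'I_l.*2.+1} :=
  if x is Node f g then [set (g b).1 | b in 'I_l] else finset.set0.

Definition default_label (x y : tree) : label :=
  (odflt ord0 [pick u | u \notin used_blurs x :|: used_blurs y], None).

Definition edge_label (x y : tree) : label :=
  match child_label x y, child_label y x with
  | Some L, _ => L
  | None, Some L => L
  | None, None => default_label x y
  end.

Fixpoint well_formed (x : tree) : Prop :=
  match x with
  | Leaf => True
  | Node f g =>
    [/\ forall b, well_formed (f b),
        forall b b', f b = f b' -> g b = g b' &
        forall b b', f b <> f b' ->
          compatible (g b) (g b') (edge_label (f b) (f b'))]
  end.

Fixpoint depth (x : tree) : nat :=
  if x is Node f _ then (\max_(b < l) depth (f b)).+1 else 0.

Lemma child_labelP x y L : child_label x y = Some L ->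
  exists f g b, [/\ x = Node f g, f b = y & g b = L].
Proof.
case: x => //= f g; case: pickP => //= b /asboolP fb [gb].
by exists f, g, b.
Qed.

Lemma child_depth x y L : child_label x y = Some L -> depth y < depth x.
Proof.
case/child_labelP => f [g [b [-> <- _]]] /=.
by rewrite ltnS (leq_bigmax (F := fun b => depth (f b))).
Qed.

Lemma child_label_Node f g b : (forall b b', f b = f b' -> g b = g b') ->
  child_label (Node f g) (f b) = Some (g b).
Proof.
move=> fg /=; case: pickP => [b' /asboolP /fg e|/(_ b)] /=; first by rewrite e.
by rewrite asboolT.
Qed.

Lemma default_labelC x y : default_label x y = default_label y x.
Proof. by rewrite /default_label finset.setUC. Qed.

Lemma edge_labelC x y : edge_label x y = edge_label y x.
Proof.
rewrite /edge_label default_labelC.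
case xy: (child_label x y) => [L|]; case yx: (child_label y x) => [L'|] //.
by have := ltn_trans (child_depth xy) (child_depth yx); rewrite ltnn.
Qed.

Lemma edge_label_child x y L : child_label x y = Some L -> edge_label x y = L.
Proof. by rewrite /edge_label => ->. Qed.

Lemma card_used_blurs x : #|used_blurs x| <= l.
Proof.
case: x => [|f g] /=; first by rewrite finset.cards0.
by rewrite (leq_trans (leq_imset_card _ _)) // card_ord.
Qed.

(** Each endpoint uses at most [l] blurs out of [l.*2.+1], so one is left over and the default
    [ord0] never arises. *)
Lemma default_label_unused x y :
  (default_label x y).1 \notin used_blurs x :|: used_blurs y.
Proof.
rewrite /default_label /=; case: pickP => //= none.
have : used_blurs x :|: used_blurs y = finset.setT.
  apply/finset.setP => u; have := none u.
  by rewrite !finset.inE => /negbFE.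
move/(congr1 (fun A : {set _} => #|A|)); rewrite cardsT card_ord => E.
have := cardsU (used_blurs x) (used_blurs y); rewrite E => E'.
have : l.*2.+1 <= l + l.
  by rewrite E' (leq_trans (leq_subr _ _)) // leq_add ?card_used_blurs.
by rewrite addnn ltnn.
Qed.

Lemma child_label_used x y L : child_label x y = Some L -> L.1 \in used_blurs x.
Proof. by case/child_labelP => f [g [b [-> _ <-]]]; apply: imset_f. Qed.

Lemma edge_label_default x y :
  child_label x y = None -> child_label y x = None ->
  edge_label x y = default_label x y.
Proof. by rewrite /edge_label => -> ->. Qed.

Lemma compatible_rot L1 L2 L3 : compatible L1 L2 L3 -> compatible L2 L3 L1.
Proof.
move=> c e1 e2; have [i1 i2 n] := c (esym (etrans e1 e2)) e1.
split; [by []|by rewrite -i2 i1|move=> o1 o2].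
by rewrite o1 o2; apply: n; rewrite ?o1 ?o2.
Qed.

Lemma compatible_swap L1 L2 L3 : compatible L1 L2 L3 -> compatible L2 L1 L3.
Proof.
move=> c e1 e2; have [i1 i2 n] := c (esym e1) (etrans e1 e2).
split; [by []|by rewrite i1|move=> o1 o2].
by rewrite o1; apply: n; rewrite ?o1 ?o2.
Qed.

(* A default edge avoids the blurs of the edges from its endpoints to their
   children, so that a triangle mixing it with such an edge is never constrained. *)
Lemma compatible_default x y z L : child_label x y = Some L ->
  child_label x z = None -> child_label z x = None ->
  compatible (edge_label x y) (edge_label x z) (edge_label y z).
Proof.
move=> xy xz zx; rewrite (edge_label_child xy) (edge_label_default xz zx).
move=> E _; have := default_label_unused x z.
by rewrite inE -E (child_label_used xy).
Qed.

Lemma compatible_child2 x y z L L' : well_formed x -> y <> z ->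
  child_label x y = Some L -> child_label x z = Some L' ->
  compatible (edge_label x y) (edge_label x z) (edge_label y z).
Proof.
move=> wx yz xy xz; rewrite (edge_label_child xy) (edge_label_child xz).
case/child_labelP: xy wx yz xz => f [g [b [-> <- <-]]] [_ _ wx] yz xz.
by case/child_labelP: xz yz => _ [_ [b' [[<- <-] <- <-]]] /wx.
Qed.

(** If [x] is a child of [z], then [z] is deeper than [y]: either [y] is also a child of [z] and
    well-formedness of [z] applies, or the edge [yz] is a default one and avoids the blurs used by
    [z]. Otherwise the same dichotomy applies at [x]. *)
Lemma compatible_child x y z L : well_formed x -> well_formed z -> y <> z ->
  child_label x y = Some L ->
  compatible (edge_label x y) (edge_label x z) (edge_label y z).
Proof.
move=> wx wz yz xy.
case xz: (child_label x z) => [L'|]; first exact: compatible_child2 xy xz.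
case zx: (child_label z x) => [L'|]; last exact: compatible_default xy xz zx.
have yzN : child_label y z = None.
  case yz': (child_label y z) => [L''|] //.
  have := ltn_trans (child_depth yz') (ltn_trans (child_depth xy) (child_depth zx)).
  by rewrite ltnn.
rewrite (edge_labelC x z) (edge_labelC y z).
apply/compatible_rot/compatible_rot.
case zy: (child_label z y) => [L''|]; last exact: compatible_default zx zy yzN.
apply: compatible_child2 zx zy => // E.
by have := child_depth xy; rewrite E ltnn.
Qed.

Lemma edge_label_compatible x y z :
  well_formed x -> well_formed y -> well_formed z ->
  x <> y -> x <> z -> y <> z ->
  compatible (edge_label x y) (edge_label x z) (edge_label y z).
Proof.
move=> wx wy wz xy xz yz.
case Exy: (child_label x y) => [L|]; first exact: compatible_child Exy.
case Exz: (child_label x z) => [L|].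
  rewrite (edge_labelC y z); apply: compatible_swap.
  by apply: compatible_child Exz => // /esym.
case Eyx: (child_label y x) => [L|].
  rewrite (edge_labelC x y); apply/compatible_rot/compatible_swap.
  exact: compatible_child Eyx.
case Eyz: (child_label y z) => [L|].
  rewrite (edge_labelC x y) (edge_labelC x z); apply: compatible_rot.
  by apply: compatible_child Eyz => // /esym.
case Ezx: (child_label z x) => [L|].
  rewrite (edge_labelC x z) (edge_labelC y z); apply/compatible_rot/compatible_rot.
  exact: compatible_child Ezx.
case Ezy: (child_label z y) => [L|].
  rewrite (edge_labelC x z) (edge_labelC y z) (edge_labelC x y).
  apply/compatible_rot/compatible_rot/compatible_swap.
  by apply: compatible_child Ezy => // /esym.
(* Three default labels carry no level, which is allowed even at constant blur. *)
by rewrite !edge_label_default.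
Qed.
End Model.

(** * The generic structure *)

Section Generic.
Variable l : nat.

Definition edge_sig : signature :=
  @Signature ('I_l.*2.+1 * 'I_l * nat)%type (fun=> 2).

Definition symbol_label (r : edge_sig) : label l := (r.1.1, Some (r.2, r.1.2)).

Definition vertex := {x : tree l | well_formed x}.

Definition vertex_label (x y : vertex) : label l := edge_label (sval x) (sval y).

Definition generic : structure edge_sig :=
  @Structure edge_sig vertex (inhabits (exist _ (Leaf l) I)) (fun r v =>
    v ord0 <> v ord_max /\ vertex_label (v ord0) (v ord_max) = symbol_label r).

Lemma vertex_eq (x y : vertex) : sval x = sval y -> x = y.
Proof. by case: x => x wx; case: y => y wy /=; exact: eq_exist. Qed.

Lemma vertex_label_compatible (x y z : vertex) : x <> y -> x <> z -> y <> z ->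
  compatible (vertex_label x y) (vertex_label x z) (vertex_label y z).
Proof.
move=> xy xz yz; apply: edge_label_compatible.
- exact: proj2_sig.
- exact: proj2_sig.
- exact: proj2_sig.
- by move/vertex_eq.
- by move/vertex_eq.
- by move/vertex_eq.
Qed.

Lemma vertex_labelC (x y : vertex) : vertex_label x y = vertex_label y x.
Proof. exact: edge_labelC. Qed.

(** The witness is the tree [Node] over these vertices: the hypotheses make it well-formed and its
    depth makes it new. *)
Lemma realize_labels (f : 'I_l -> vertex) (g : 'I_l -> label l) :
  (forall b b', f b = f b' -> g b = g b') ->
  (forall b b', f b <> f b' ->
     compatible (g b) (g b') (vertex_label (f b) (f b'))) ->
  exists x : vertex, forall b, x <> f b /\ vertex_label x (f b) = g b.
Proof.
move=> fg cg; pose t := Node (fun b => sval (f b)) g.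
have wt : well_formed t.
  split=> [b|b b' /vertex_eq/fg //|b b' fb]; first exact: proj2_sig.
  by apply: cg => E; apply: fb; rewrite E.
exists (exist _ t wt) => b.
have tb : child_label t (sval (f b)) = Some (g b).
  by apply: (@child_label_Node _ (fun b => sval (f b)) g b) => ? ? /vertex_eq/fg.
split; last exact: edge_label_child tb.
by move=> E; have := child_depth tb; rewrite -E ltnn.
Qed.

(** * Back-and-forth between similar tuples *)

Section Similarity.
Variables (tau : option nat -> option nat) (K : nat).
Hypothesis tauK : involutive tau.
Hypothesis tau_id : forall k, k < K -> tau (Some k) = Some k.

(** [tau] permutes the levels, [None] counting as one; colours are preserved only at levels below
    [K], the only ones that formulas of bound [K] mention. *)
Definition label_sim (L L' : label l) : Prop :=
  [/\ L'.1 = L.1, level L' = tau (level L) &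
      forall k c, k < K -> L.2 = Some (k, c) <-> L'.2 = Some (k, c)].

Definition sim (T : Type) (s s' : T -> vertex) : Prop := forall a b,
  (s a = s b <-> s' a = s' b) /\
  (s a <> s b -> label_sim (vertex_label (s a) (s b)) (vertex_label (s' a) (s' b))).

Lemma label_sim_sym L L' : label_sim L L' -> label_sim L' L.
Proof.
case=> u i o; split=> [//||k c kK]; first by rewrite i tauK.
exact: iff_sym (o _ _ kK).
Qed.

Lemma sim_sym T (s s' : T -> vertex) : sim s s' -> sim s' s.
Proof.
move=> ss a b; have [e d] := ss a b; split; first exact: iff_sym.
by move=> n; apply/label_sim_sym/d => /e.
Qed.

Lemma sim_comp T U (h : U -> T) (s s' : T -> vertex) :
  sim s s' -> sim (s \o h) (s' \o h).
Proof. by move=> ss a b; exact: ss. Qed.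

(* When the level of an edge to the b-th vertex is missing or at least K, b itself
   serves as a colour: distinct vertices get distinct colours, so that no triangle
   through the new vertex becomes monochromatic. *)
Definition relabel (L : label l) (b : 'I_l) : label l :=
  (L.1, if L.2 is Some (k, c) then
          if k < K then L.2 else omap (pair^~ b) (tau (Some k))
        else omap (pair^~ b) (tau None)).

Lemma level_relabel L b : level (relabel L b) = tau (level L).
Proof.
case: L => u [[k c]|]; rewrite /level /relabel /=; last by case: (tau None).
by case: ifP => [/tau_id //|_]; case: (tau _).
Qed.

Lemma tau_lt t k : k < K -> tau t = Some k -> t = Some k.
Proof. by move=> kK E; rewrite -(tauK t) E tau_id. Qed.

Lemma relabel_sim L b : label_sim L (relabel L b).
Proof.
split=> [//||k c kK]; first exact: level_relabel.
split=> E; first by rewrite /relabel /= E kK.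
have : tau (level L) = Some k by rewrite -(level_relabel L b) /level E.
move/(tau_lt kK); move: E; case: L => u [[k' c']|] //= E.
by rewrite /level /= => -[k'k]; move: E; rewrite k'k kK.
Qed.

Lemma relabel_color L b k c : (relabel L b).2 = Some (k, c) ->
  (k < K /\ L.2 = Some (k, c)) \/ c = b.
Proof.
case: L => u [[k' c']|] /=; last by case: (tau None) => //= ? [_ ->]; right.
case: ifP => [kK [<- <-]|_]; first by left.
by case: (tau _) => //= ? [_ ->]; right.
Qed.

(** If the three new labels were named and equal at a level below [K], the old ones would be too; at
    any other level the first two colours are [b1] and [b2], which differ. *)
Lemma sim_compatible (L1 L2 L3 L3' : label l) b1 b2 : b1 <> b2 ->
  label_sim L3 L3' -> compatible L1 L2 L3 ->
  compatible (relabel L1 b1) (relabel L2 b2) L3'.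
Proof.
move=> b12 [u3 i3 o3] c u12 u23.
have [//||i12 i23 n] := c; first by rewrite -u3.
rewrite !level_relabel i3 i12 i23; split=> // o12 o23.
case E: (relabel L1 b1).2 => [[k col]|] //.
have E2 := E; rewrite o12 in E2; have E3 := E2; rewrite o23 in E3.
case: (relabel_color E) => [[kK e1]|c1].
  have e2 : L2.2 = Some (k, col).
    by have [_ _ o] := relabel_sim L2 b2; apply/(o _ _ kK).
  have e3 : L3.2 = Some (k, col) by apply/(o3 _ _ kK).
  by have := n (etrans e1 (esym e2)) (etrans e2 (esym e3)); rewrite e1.
case: (relabel_color E2) => [[kK e2]|c2]; last by case: b12; rewrite -c1.
have e1 : L1.2 = Some (k, col).
  by have [_ _ o] := relabel_sim L1 b1; apply/(o _ _ kK).
have e3 : L3.2 = Some (k, col) by apply/(o3 _ _ kK).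
by have := n (etrans e1 (esym e2)) (etrans e2 (esym e3)); rewrite e1.
Qed.

Lemma sim_extend (s s' : 'I_l -> vertex) (x : vertex) : sim s s' ->
  exists x', sim (oapp s x) (oapp s' x').
Proof.
move=> ss.
have [[b xb]|xs] := pselect (exists b, x = s b).
  exists (s' b); have -> : oapp s x = s \o oapp id b by apply/funext => -[].
  have -> : oapp s' (s' b) = s' \o oapp id b by apply/funext => -[].
  exact: sim_comp.
(* The colours given to [relabel] must separate distinct vertices and agree on repeated ones, so
   each vertex of [s'] is represented by one index. *)
pose first b := odflt b [pick b' | `[< s' b' = s' b >]].
have firstP b : s' (first b) = s' b.
  by rewrite /first; case: pickP => //= b' /asboolP.
have first_eq b b' : s' b = s' b' -> first b = first b'.
  rewrite /first => ->; case: pickP => //= /(_ b').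
  by rewrite asboolT.
pose g b := relabel (vertex_label x (s b)) (first b).
have [|b b' bb'|x' x'P] := @realize_labels s' g.
- move=> b b' bb'; have [[_ e] _] := ss b b'.
  by rewrite /g (e bb') (first_eq _ _ bb').
- have [[e _] d] := ss b b'; have sbb' : s b <> s b' by move/e.
  apply: sim_compatible (d sbb') _.
    by move=> f; apply: bb'; rewrite -(firstP b) f firstP.
  by apply: vertex_label_compatible => // E; apply: xs; [exists b|exists b'].
have xsb b : x <> s b by move=> E; apply: xs; exists b.
have xl b : label_sim (vertex_label x (s b)) (vertex_label x' (s' b)).
  by have [_ ->] := x'P b; exact: relabel_sim.
exists x' => -[b|] [b'|] /=.
- exact: ss.
- split; first by split=> /esym E; [case: (xsb b)|have [] := x'P b].
  by rewrite (vertex_labelC (s b)) (vertex_labelC (s' b)).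
- by split; first by split=> E; [case: (xsb b')|have [] := x'P b'].
- by [].
Qed.
End Similarity.
End Generic.

(** * Invariance of formulas with bounded levels *)

Section Invariance.
Variables (n l : nat).
Hypotheses (n_gt0 : 0 < n) (n_le_l : n <= l).
Local Notation M := (generic l).

Section Fixed.
Variables (tau : option nat -> option nat) (K : nat).
Hypothesis tauK : involutive tau.
Hypothesis tau_id : forall k, k < K -> tau (Some k) = Some k.
Local Notation sim := (sim tau K).

Lemma sim_update q (q_le_l : q <= l) (s s' : 'I_q -> vertex l) a x :
  sim s s' -> exists x', sim [eta s with a |-> x] [eta s' with a |-> x'].
Proof.
(* [p] pads the tuple to length [l] by repeating position [a]. The old value at [a] is kept during
   the extension and dropped only by [h]. *)
move=> ss; pose p (b : 'I_l) : 'I_q := insubd a (val b).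
have pK b : p (widen_ord q_le_l b) = b by rewrite /p valKd.
have [x' xx'] := sim_extend tauK tau_id x (sim_comp p ss).
pose h b := if b == a then None else Some (widen_ord q_le_l b).
exists x'.
have hE (t : 'I_q -> vertex l) y :
    [eta t with a |-> y] =1 oapp (t \o p) y \o h.
  by move=> b; rewrite /h /=; case: eqP => //= _; rewrite pK.
by rewrite (funext (hE s x)) (funext (hE s' x')); exact: sim_comp.
Qed.

Lemma sim_updates q (q_le_l : q <= l) (L : seq 'I_q) (s s' t : 'I_q -> vertex l) :
  sim s s' -> exists t',
    sim (fun b => if b \in L then t b else s b) t' /\
    forall b, b \notin L -> t' b = s' b.
Proof.
move=> ss; elim: L => [|a L [t' [tt' t's']]]; first by exists s'.
have [x' xx'] := sim_update q_le_l a (t a) tt'.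
exists [eta t' with a |-> x']; split=> [|b].
  move: xx'; congr (sim _ _); apply/funext => b /=; rewrite in_cons.
  by case: eqP => [->|].
by rewrite in_cons negb_or => /andP[/negPf ba /t's' bs] /=; rewrite ba.
Qed.

Fixpoint fo_bound k m (f : fo_formula (expand_sig (edge_sig l) n k) m) : nat :=
  match f with
  | FoBot | FoEq _ _ => 0
  | FoRel r _ => if r is inl r then r.2.+1 else 0
  | FoNot f | FoEx _ f => fo_bound f
  | FoAnd f g => maxn (fo_bound f) (fo_bound g)
  end.

Lemma symbol_label_sim L L' (r : edge_sig l) : r.2 < K -> label_sim tau K L L' ->
  L = symbol_label r <-> L' = symbol_label r.
Proof.
move=> rK [u _ o]; rewrite /symbol_label.
have {}o := o r.2 r.1.2 rK.
move: L L' u o => [u o] [u' o'] /= -> oo.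
by split=> -[-> e]; congr (_, _); apply/oo.
Qed.

Lemma interp_sim (r : edge_sig l) (v v' : 'I_2 -> vertex l) :
  r.2 < K -> sim v v' -> @interp _ M r v <-> @interp _ M r v'.
Proof.
move=> rK vv; have [e d] := vv ord0 ord_max.
have ne : v ord0 <> v ord_max <-> v' ord0 <> v' ord_max.
  by split=> E /e.
by split=> -[/[dup] nv /ne nv'] L; split=> //;
  apply/(symbol_label_sim rK (d _)).
Qed.

Lemma fo_sat_sim k (P : 'I_k -> ('I_n -> M) -> Prop) :
  (forall j (s s' : 'I_n -> vertex l), sim s s' -> P j s <-> P j s') ->
  forall (f : fo_formula (expand_sig (edge_sig l) n k) l) (s s' : 'I_l -> vertex l),
  fo_bound f <= K -> sim s s' ->
  @fo_sat _ _ (expand_structure P) f s <-> @fo_sat _ _ (expand_structure P) f s'.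
Proof.
move=> PP; elim=> [|i j|r x|f IHf|f IHf g IHg|i f IHf] s s' /=.
- by [].
- by move=> _ /(_ i j) [].
- case: r x => [r|j] /= x rK ss.
    exact: interp_sim rK (sim_comp x ss).
  exact: PP (sim_comp x ss).
- by move=> fK /(IHf _ _ fK) ff; split=> nf /ff.
- rewrite geq_max => /andP[fK gK] ss.
  have ff := IHf _ _ fK ss; have gg := IHg _ _ gK ss.
  by split=> -[/ff ? /gg ?].
- move=> fK ss; split=> -[a fa].
    have [a' aa'] := sim_update (leqnn l) i a ss.
    by exists a'; apply/(IHf _ _ fK aa').
  have [a' aa'] := sim_update (leqnn l) i a (sim_sym tauK ss).
  by exists a'; apply/(IHf _ _ fK aa').
Qed.

Variable E : extension (edge_sig l) n l.

Fixpoint bound (f : formula E) : nat :=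
  match f with
  | Bot | Eq _ _ => 0
  | Rel r _ => r.2.+1
  | Not f | Ex _ f => bound f
  | And f g => maxn (bound f) (bound g)
  | Conn c args => maxn (fo_bound (defining c)) (\max_(k < rank c) bound (args k))
  end.

Lemma sat_sim (f : formula E) (s s' : 'I_n -> vertex l) :
  bound f <= K -> sim s s' -> @sat _ _ _ _ M f s <-> @sat _ _ _ _ M f s'.
Proof.
elim: f s s' => [|i j|r x|f IHf|f IHf g IHg|i f IHf|c args IH] s s' /=.
- by [].
- by move=> _ /(_ i j) [].
- by move=> rK ss; exact: interp_sim rK (sim_comp x ss).
- by move=> fK /(IHf _ _ fK) ff; split=> nf /ff.
- rewrite geq_max => /andP[fK gK] ss.
  have ff := IHf _ _ fK ss; have gg := IHg _ _ gK ss.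
  by split=> -[/ff ? /gg ?].
- move=> fK ss; split=> -[a fa].
    have [a' aa'] := sim_update n_le_l i a ss.
    by exists a'; apply/(IHf _ _ fK aa').
  have [a' aa'] := sim_update n_le_l i a (sim_sym tauK ss).
  by exists a'; apply/(IHf _ _ fK aa').
- rewrite geq_max => /andP[cK /bigmax_leqP argsK] ss.
  pose P k (v : 'I_n -> M) := @sat _ _ _ _ M (args k) v.
  have PP j (v v' : 'I_n -> vertex l) : sim v v' -> P j v <-> P j v'.
    exact/IH/argsK.
  suff half (v v' : 'I_n -> vertex l) : sim v v' ->
    (exists t : 'I_l -> M, (forall (i : 'I_n) (j : 'I_l), i = j :> nat -> t j = v i) /\
      @fo_sat _ _ (expand_structure P) (defining c) t) ->
    exists t : 'I_l -> M, (forall (i : 'I_n) (j : 'I_l), i = j :> nat -> t j = v' i) /\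
      @fo_sat _ _ (expand_structure P) (defining c) t.
    by split; apply: half => //; exact: sim_sym.
  move=> {}ss [t [tv ft]].
  (* The values of [t] beyond the first [n] variables are arbitrary. Starting from [v] and [v']
     pulled back along [p], they are written in one by one, while the positions below [n] keep the
     values of [v']. *)
  pose p (b : 'I_l) : 'I_n := insubd (Ordinal n_gt0) (val b).
  have pE (i : 'I_n) (j : 'I_l) : i = j :> nat -> p j = i.
    by move=> ij; apply: val_inj; rewrite val_insubd /= -ij ltn_ord.
  pose L := [seq b : 'I_l <- enum 'I_l | n <= b].
  have inL (b : 'I_l) : (b \in L) = (n <= b) by rewrite mem_filter mem_enum andbT.
  have [t' [tt' t'v']] := sim_updates (leqnn l) L t (sim_comp p ss).
  exists t'; split=> [i j ij|].
    by rewrite t'v' ?inL -?ij -?ltnNge // /= (pE i).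
  apply/(fo_sat_sim PP cK tt'); move: ft; congr fo_sat; apply/funext => b.
  rewrite inL; case: leqP => //= bn.
  by rewrite (tv (Ordinal bn)) // (pE (Ordinal bn)).
Qed.

End Fixed.
End Invariance.

(** * Atoms of the generic structure *)

Lemma compl_coatom d (B : ctbDistrLatticeType d) (a : B) :
  coatom a -> atom (~` a)%O.
Proof.
case=> aT am; split=> [E|x xa]; first by apply: aT; rewrite -(complK a) E compl0.
have : (a <= ~` x)%O by rewrite -(complK a) leC.
by case/am => E; [left; rewrite -(complK x) E compl1|right; rewrite -E complK].
Qed.

Section Standard.
Variables (n l : nat).
Hypotheses (n_gt0 : 0 < n) (n_le_l : n <= l).
Local Notation M := (generic l).

Definition standard (T : Type) (s : T -> vertex l) : Prop :=
  forall a b, s a <> s b -> (vertex_label (s a) (s b)).2 <> None.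

(* Exchanges "no level" ([None]) with a large level k0 that does not occur. *)
Definition swap_level (k0 : nat) (t : option nat) : option nat :=
  if t == None then Some k0 else if t == Some k0 then None else t.

Lemma swap_levelK k0 : involutive (swap_level k0).
Proof.
case=> [k|] /=; rewrite /swap_level /= ?eqxx //.
by case: (eqVneq (Some k) (Some k0)) => [->|/negPf] //= ->.
Qed.

(** [None] is exchanged with a level that is at least [K] and above all levels in [s]. Since that
    level does not occur in [s], no edge of [s'] ends up unnamed. *)
Lemma standardize K (s : 'I_n -> vertex l) : exists tau s',
  [/\ involutive tau, forall k, k < K -> tau (Some k) = Some k,
      sim tau K s s' & standard s'].
Proof.
pose lev a b := odflt 0 (level (vertex_label (s a) (s b))).
pose m := \max_(a < n) \max_(b < n) lev a b.
pose tau := swap_level (maxn K m.+1).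
have tauK : involutive tau := swap_levelK _.
have tau_id k : k < K -> tau (Some k) = Some k.
  move=> kK; rewrite /tau /swap_level /=; case: eqP => // -[E].
  by have := leq_maxl K m.+1; rewrite -E leqNgt kK.
(* A constant tuple has no edges, hence is similar to itself; overwriting all its positions by [s]
   yields [s']. *)
pose s0 (_ : 'I_n) := s (Ordinal n_gt0).
have ss0 : sim tau K s0 s0 by [].
have [s' [ss' _]] := sim_updates tauK tau_id n_le_l (enum 'I_n) s ss0.
have {}ss' : sim tau K s s'.
  by move: ss'; congr (sim _ _ _); apply/funext => b; rewrite mem_enum.
exists tau, s'; split=> // a b s'ab.
have [[e _] d] := ss' a b.
have [_ + _] := d (fun E => s'ab (e E)).
have : level (vertex_label (s a) (s b)) <> Some (maxn K m.+1).
  move=> E; have : lev a b <= m.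
    apply: leq_trans (leq_bigmax (F := fun b => lev a b) b) _.
    exact: (leq_bigmax (F := fun a => \max_(b < n) lev a b) a).
  rewrite /lev E /= leqNgt => /negP[].
  exact: leq_maxr.
rewrite /tau /swap_level; case: (level _) => [k|] /=.
  by case: eqP => // _ _; rewrite /level; case: (_.2).
by rewrite /level; case: (_.2).
Qed.

Variable E : extension (edge_sig l) n l.

Definition edge_formula (r : edge_sig l) (i j : 'I_n) : formula E :=
  Rel E (r := r) (fun a => if a == ord0 then i else j).

Lemma sat_edge (N : structure (edge_sig l)) r i j (s : 'I_n -> N) :
  sat (edge_formula r i j) s <->
  @interp _ N r (fun a => if a == ord0 then s i else s j).
Proof.
rewrite /=; have -> // : s \o (fun a : 'I_2 => if a == ord0 then i else j) =
  (fun a : 'I_2 => if a == ord0 then s i else s j).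
by apply/funext => a /=; case: ifP.
Qed.

Lemma sat_edge_generic r i j (s : 'I_n -> vertex l) :
  @sat _ n l E M (edge_formula r i j) s <->
  s i <> s j /\ vertex_label (s i) (s j) = symbol_label r.
Proof. exact: sat_edge. Qed.

(** No symbol describes an unnamed edge, hence [Bot]: the type formula of a non-standard tuple is
    unsatisfiable. *)
Definition pair_formula (s : 'I_n -> vertex l) (a b : 'I_n) : formula E :=
  if `[< s a = s b >] then Eq E a b else
  let L := vertex_label (s a) (s b) in
  if L.2 is Some (k, c) then edge_formula (L.1, c, k) a b else Bot E.

Definition type_formula (s : 'I_n -> vertex l) : formula E :=
  foldr (@And _ _ _ E) (Top E)
    [seq pair_formula s a b | a <- enum 'I_n, b <- enum 'I_n].

Lemma sat_foldr_And (N : structure (edge_sig l)) (L : seq (formula E)) (t : 'I_n -> N) :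
  sat (foldr (@And _ _ _ E) (Top E) L) t <-> forall f, f \in L -> sat f t.
Proof.
elim: L => [|f L [IH1 IH2]] /=; first by split=> // _ [].
split=> [[ft /IH1 Lt] g|H].
  by rewrite in_cons => /orP[/eqP -> //|/Lt].
split; first by apply: H; rewrite mem_head.
by apply: IH2 => g gL; apply: H; rewrite in_cons gL orbT.
Qed.

Lemma sat_type_formula (s t : 'I_n -> vertex l) :
  @sat _ n l E M (type_formula s) t <->
  forall a b, @sat _ n l E M (pair_formula s a b) t.
Proof.
split=> [/sat_foldr_And H a b|H].
  by apply: H; apply/allpairsP; exists (a, b); rewrite !mem_enum.
by apply/sat_foldr_And => f /allpairsP[[a b] [_ _ ->]].
Qed.

Lemma sat_type_formula_self s : standard s -> @sat _ n l E M (type_formula s) s.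
Proof.
move=> st; apply/sat_type_formula => a b; rewrite /pair_formula.
case: asboolP => [//|/[dup] ab /st].
case E2: (vertex_label (s a) (s b)).2 => [[k c]|] // _.
apply/sat_edge_generic; split=> //.
by rewrite /symbol_label /= -E2; case: vertex_label.
Qed.

(** The type formula forces the same equalities and labels, so [s] and [t] are similar with [tau]
    the identity. *)
Lemma type_formula_complete (f : formula E) s t :
  @sat _ n l E M (type_formula s) t ->
  @sat _ n l E M f s <-> @sat _ n l E M f t.
Proof.
move/sat_type_formula => st.
apply: (@sat_sim n l n_gt0 n_le_l id (bound f)) => // a b.
have := st a b; rewrite /pair_formula.
case: asboolP => [ab /= tab|ab]; first by split.
case E2: (vertex_label (s a) (s b)).2 => [[k c]|] //.
move/sat_edge_generic => [tab L]; split=> [//|_].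
have -> : vertex_label (t a) (t b) = vertex_label (s a) (s b).
  by rewrite L /symbol_label /= -E2; case: vertex_label.
by [].
Qed.

(** * The Tarski-Lindenbaum algebra computed in the generic structure *)

Section Theory.
Variable T : set (formula E).
Hypothesis model_T : model M T.
Hypothesis T_complete : forall f : formula E, (forall s, @sat _ n l E M f s) ->
  forall N : structure (edge_sig l), model N T -> forall s, @sat _ _ _ _ N f s.

Lemma tl_class_eqP (f g : formula E) : tl_class T f = tl_class T g <->
  forall s, @sat _ n l E M f s <-> @sat _ n l E M g s.
Proof.
split=> [/tl_classP|fg]; first exact.
apply/tl_classP => N NT s.
pose h := And (Not (And f (Not g))) (Not (And g (Not f))).
have [] : sat h s.
  by apply: T_complete NT s => s; have := fg s; rewrite /=; tauto.
by rewrite /=; case: (EM (sat f s)); case: (EM (sat g s)); tauto.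
Qed.

Lemma tl_class_leP (f g : formula E) : (tl_class T f <= tl_class T g)%O <->
  forall s, @sat _ n l E M f s -> @sat _ n l E M g s.
Proof.
rewrite leEmeet /Order.meet /= tl_andE.
split=> [/eqP/tl_class_eqP fg s /fg[]//|fg].
by apply/eqP/tl_class_eqP => s /=; have := fg s; tauto.
Qed.

Lemma tl_class_botP (f : formula E) : tl_class T f <> \bot%O <->
  exists s, @sat _ n l E M f s.
Proof.
split=> [fN|[s fs] /tl_class_eqP/(_ s)[/(_ fs)]//].
apply: contrapT => nf; apply/fN/tl_class_eqP => s; split=> // fs.
by case: nf; exists s.
Qed.

Lemma atomP (f : formula E) : atom (tl_class T f) <->
  (exists s, @sat _ n l E M f s) /\
  forall g s t, @sat _ n l E M f s -> @sat _ n l E M f t ->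
    @sat _ n l E M g s -> @sat _ n l E M g t.
Proof.
split=> [[/tl_class_botP f0 fm]|[f0 fc]]; split=> //.
- move=> g s t fs ft gs; case: (fm (tl_class T (And f g))).
  + by apply/tl_class_leP => ? [].
  + by case/tl_class_eqP/(_ s) => /(_ (conj fs gs)).
  + by case/tl_class_eqP/(_ t) => _ /(_ ft)[].
- exact/tl_class_botP.
- move=> x; rewrite -(tl_reprK x); move: (repr x) => g /tl_class_leP gf.
  have [[s gs]|ng] := pselect (exists s, @sat _ n l E M g s); [right|left].
    apply/tl_class_eqP => t; split=> [/gf//|ft].
    exact: fc (gf _ gs) ft gs.
  by apply/tl_class_eqP => s; split=> // gs; case: ng; exists s.
Qed.

Lemma standard_atom s : standard s -> atom (tl_class T (type_formula s)).
Proof.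
move=> st; apply/atomP; split; first by exists s; exact: sat_type_formula_self.
move=> g t t' /(type_formula_complete g) H /(type_formula_complete g) H' gt.
exact/H'/H.
Qed.

(** A satisfiable [f] holds at some standard tuple, by similarity up to [bound f], and the type
    formula of that tuple implies [f]. *)
Lemma atomic_T : atomic_theory T.
Proof.
move=> x; rewrite -(tl_reprK x); move: (repr x) => f /tl_class_botP[s fs].
have [tau [s' [tauK tau_id ss' st]]] := standardize (bound f) s.
have fs' : @sat _ n l E M f s'.
  exact/(sat_sim n_gt0 n_le_l tauK tau_id (leqnn _) ss').
exists (tl_class T (type_formula s')); split; first exact: standard_atom.
by apply/tl_class_leP => t /(type_formula_complete f) H; apply/H.
Qed.

(* An atom satisfied by a tuple with an unlabelled edge would also be satisfied by
   a similar standard tuple, which an edge formula tells apart. *)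
Lemma atom_standard f s : atom (tl_class T f) -> @sat _ n l E M f s -> standard s.
Proof.
move=> /atomP[_ fc] fs a b sab L0.
have [tau [s' [tauK tau_id ss' st]]] := standardize (bound f) s.
have fs' : @sat _ n l E M f s'.
  exact/(sat_sim n_gt0 n_le_l tauK tau_id (leqnn _) ss').
have [[_ e] _] := ss' a b.
have s'ab : s' a <> s' b by move/e.
have := st a b s'ab.
case E2: (vertex_label (s' a) (s' b)).2 => [[k c]|] // _.
have := fc (edge_formula ((vertex_label (s' a) (s' b)).1, c, k) a b) s' s fs' fs.
case.
  apply/sat_edge_generic; split=> //.
  by rewrite /symbol_label /= -E2; case: vertex_label.
by move=> _; rewrite /= => L; move: L0; rewrite -/(vertex_label _ _) L.
Qed.

Definition exists_all (f : formula E) : formula E := foldr (@Ex _ _ _ E) f (enum 'I_n).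

Lemma sat_foldr_Ex (N : structure (edge_sig l)) (L : seq 'I_n) f (s : 'I_n -> N) :
  sat (foldr (@Ex _ _ _ E) f L) s <->
  exists t, (forall i, i \notin L -> t i = s i) /\ sat f t.
Proof.
elim: L s => [|i L IH] s /=.
  split=> [fs|[t [ts]]]; first by exists s.
  by have -> : t = s by apply/funext => j; apply: ts.
split=> [[a /IH[t [ts ft]]]|[t [ts ft]]].
  exists t; split=> // j; rewrite in_cons negb_or => /andP[/negPf ji /ts ->] /=.
  by rewrite ji.
exists (t i); apply/IH; exists t; split=> // j jL /=.
by case: eqP => [-> //|/eqP ji]; apply: ts; rewrite in_cons negb_or ji.
Qed.

Lemma sat_exists_all (N : structure (edge_sig l)) f (s : 'I_n -> N) :
  sat (exists_all f) s <-> exists t : 'I_n -> N, sat f t.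
Proof.
split=> [/sat_foldr_Ex[t [_ ft]]|[t ft]]; first by exists t.
by apply/sat_foldr_Ex; exists t; split=> // i; rewrite mem_enum.
Qed.

Lemma cong_exists_all R (cR : congruence R) x y : R x y ->
  R (foldr (@tl_ex _ _ _ E T) x (enum 'I_n)) (foldr (@tl_ex _ _ _ E T) y (enum 'I_n)).
Proof. by move=> xy; elim: (enum _) => //= i L; exact: cong_ex. Qed.

Lemma tl_exists_all f : foldr (@tl_ex _ _ _ E T) (tl_class T f) (enum 'I_n) =
  tl_class T (exists_all f).
Proof. by rewrite /exists_all; elim: (enum _) => //= i L ->; rewrite tl_exE. Qed.

(** If [u] and [v] are congruent and some tuple satisfies [u] but not [v], then [And u (Not v)] is
    congruent to bottom. Quantifying all [n] variables turns it into top and fixes bottom, so the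
    congruence is total. *)
Lemma complete_T : complete_theory T.
Proof.
split.
  exists (tl_class T (Top E)), (tl_class T (Bot E)) => /tl_class_eqP.
  by move/(_ (fun=> exist _ (Leaf l) I)) => /= -[/(_ id)].
move=> R cR; have [?|] := pselect (forall x y, R x y -> x = y); first by left.
move=> /existsNP[x /existsNP[y /not_implyP[Rxy xy]]]; right.
have key u v f s : R (tl_class T u) (tl_class T v) -> f = And u (Not v) ->
    @sat _ n l E M f s -> R \top%O \bot%O.
  move=> Ruv -> us.
  have := cong_and cR Ruv (cong_refl cR (~` tl_class T v)%O).
  rewrite meetxC => /(cong_exists_all cR).
  rewrite /Order.meet /Order.compl /= tl_notE tl_andE tl_exists_all.
  have -> : tl_class T (exists_all (And u (Not v))) = \top%O.
    by apply/tl_class_eqP => t; split=> [_ []|_]; apply/sat_exists_all; exists s.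
  suff -> : foldr (@tl_ex _ _ _ E T) \bot%O (enum 'I_n) = \bot%O by [].
  rewrite tl_exists_all; apply/tl_class_eqP => t; split=> //.
  by case/sat_exists_all.
have Rtop : R \top%O \bot%O.
  move: Rxy xy; rewrite -(tl_reprK x) -(tl_reprK y).
  move: (repr x) (repr y) => u v Ruv uv.
  have [[s [us vs]]|nuv] :=
    pselect (exists s, @sat _ n l E M u s /\ ~ @sat _ n l E M v s).
    exact: (key u v _ s Ruv erefl).
  have [[s [us vs]]|nvu] :=
    pselect (exists s, @sat _ n l E M v s /\ ~ @sat _ n l E M u s).
    exact: (key v u _ s (cong_sym cR Ruv) erefl).
  case: uv; apply/tl_class_eqP => s; split=> us; apply: contrapT => vs.
    by case: nuv; exists s.
  by case: nvu; exists s.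
have R0 z : R z \bot%O.
  have := cong_and cR (cong_refl cR z) Rtop.
  by rewrite meetx1 meetx0.
by move=> z w; apply: cong_trans (R0 z) (cong_sym cR (R0 w)).
Qed.

End Theory.
End Standard.

Arguments sat_edge {n l} E {N r i j s}.
Arguments sat_edge_generic {n l} E {r i j s}.

(** * The theory of the generic structure *)

Section Ramsey.
Local Open Scope classical_set_scope.

(** Induction on the number of colours allowed on an infinite set: some [x] has infinitely many
    neighbours of one colour [c], and either two of them are joined by [c] or [c] is absent among
    them. *)
Lemma mono_triangle (C : finType) (X : Type) (chi : X -> X -> C) (A : set X) :
  infinite_set A -> exists x y z,
    [/\ x <> y, x <> z, y <> z, chi x z = chi x y & chi y z = chi x y].
Proof.
move=> Ainf.
suff H (D : {set C}) (B : set X) : infinite_set B ->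
    (forall x y, B x -> B y -> x <> y -> chi x y \in D) -> exists x y z,
    [/\ x <> y, x <> z, y <> z, chi x z = chi x y & chi y z = chi x y].
  exact: (H finset.setT A).
have [m] := ubnP #|D|; elim: m D B => // m IH D B Dm Binf BD.
have [x Bx] : B !=set0 by apply: infinite_setN0.
have Bx_inf : infinite_set (B `\ x).
  move=> fin; apply: Binf; apply: (@sub_finite_set _ _ (B `\ x `|` [set x])).
    by move=> y By; have [->|] := pselect (y = x); [right|left].
  by rewrite finite_setU; split => //; exact: finite_set1.
have [c Bc_inf] : exists c, infinite_set [set y | (B `\ x) y /\ chi x y = c].
  apply: contrapT => /forallNP fin; apply: Bx_inf.
  apply: (@sub_finite_set _ _
    (\bigcup_(c in [set: C]) [set y | (B `\ x) y /\ chi x y = c])).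
    by move=> y By; exists (chi x y).
  by apply: bigcup_finite => // c _; exact: contrapT.
have [y [[By /= yx] xyc]] := infinite_setN0 Bc_inf.
have cD : c \in D by rewrite -xyc; apply: BD => // /esym.
have [[z [w [[[Bz zx] xz] [[Bw wx] xw] zw zwc]]]|none] := pselect (exists z w,
    [/\ (B `\ x) z /\ chi x z = c, (B `\ x) w /\ chi x w = c, z <> w & chi z w = c]).
  by exists x, z, w; rewrite xz; split=> // /esym.
apply: (IH (D :\ c)%SET _ _ Bc_inf).
  by rewrite -ltnS (leq_trans _ Dm) // (finset.cardsD1 c D) cD.
move=> z w [[Bz zx] xz] [[Bw wx] xw] zw; rewrite !finset.inE BD // andbT.
by apply/eqP => zwc; apply: none; exists z, w.
Qed.
End Ramsey.

(** * A countable axiomatisation and its models *)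

Section Main.
Variables (n l : nat).
Hypotheses (n_gt2 : 2 < n) (n_le_l : n <= l).
Local Notation M := (generic l).

Let n_gt0 : 0 < n. Proof. exact: ltn_trans n_gt2. Qed.
Let l_gt0 : 0 < l. Proof. exact: leq_trans n_le_l. Qed.

Variable E : extension (edge_sig l) n l.

Definition edge_code (r : edge_sig l) : nat :=
  pickle (r : 'I_l.*2.+1 * 'I_l * nat)%type.

Lemma edge_code_inj : injective edge_code.
Proof. exact: pcan_inj pickleK. Qed.

Local Notation code := (@code _ n l E edge_code).

(** Keeping one formula per code makes the theory countable however many connectives [E] has. *)
Definition canonical_form (f : formula E) : formula E :=
  xget (Bot E) [set g | code g = code f]%classic.

Lemma code_canonical_form f : code (canonical_form f) = code f.
Proof.
exact: (@xgetPex _ _ [set g | code g = code f]%classic (ex_intro _ f erefl)).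
Qed.

Lemma canonical_form_eq f g : code f = code g -> canonical_form f = canonical_form g.
Proof. by rewrite /canonical_form => ->. Qed.

Definition generic_theory : set (formula E) :=
  [set f | [/\ sentence f, forall s, @sat _ n l E M f s
            & canonical_form f = f]]%classic.

Lemma model_generic_theory : model M generic_theory.
Proof. by move=> f []. Qed.

Lemma free_exists_all (f : formula E) i : ~~ free i (exists_all f).
Proof.
rewrite /exists_all; have : i \in enum 'I_n by rewrite mem_enum.
elim: (enum _) => //= j L IH; rewrite in_cons.
by case: eqP => //= _; exact: IH.
Qed.

(** The universal closure of [f] is a sentence true in [M]; its canonical form is equivalent to it
    in all structures and belongs to the theory. *)
Lemma generic_theory_complete (f : formula E) : (forall s, @sat _ n l E M f s) ->
  forall N : structure (edge_sig l), model N generic_theory ->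
  forall s, @sat _ n l E N f s.
Proof.
move=> Mf N NT s; pose h := Not (exists_all (Not f)).
have [hh free_h] := code_equiv edge_code_inj (code_canonical_form h).
have Th : generic_theory (canonical_form h).
  split=> [i|t|]; first by rewrite free_h /= free_exists_all.
    by apply/hh => /sat_exists_all[t'] /(_ (Mf t')).
  exact/canonical_form_eq/code_canonical_form.
have : @sat _ n l E N h s by apply/hh; exact: NT Th s.
by move=> nh; apply: contrapT => nf; apply/nh/sat_exists_all; exists s.
Qed.

Lemma countable_generic_theory : countable generic_theory.
Proof.
apply/countable_injP; exists (pickle \o code) => f g.
rewrite !inE => -[_ _ ff] [_ _ gg] /(pcan_inj pickleK) fg.
by rewrite -ff -gg; exact: canonical_form_eq.
Qed.

Section NonAtomic.
Variable N : structure (edge_sig l).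
Hypothesis model_N : model N generic_theory.

Definition edge (r : edge_sig l) (x y : N) : Prop :=
  @interp _ N r (fun a => if a == ord0 then x else y).

Let i0 : 'I_n := Ordinal n_gt0.
Let i1 : 'I_n := Ordinal (ltn_trans (ltnSn 1) n_gt2).
Let i2 : 'I_n := Ordinal n_gt2.
Let c0 : 'I_l := Ordinal l_gt0.
Let assign (A : Type) (x y z : A) (i : 'I_n) : A :=
  if i == i0 then x else if i == i1 then y else z.

Lemma transfer (f : formula E) (s : 'I_n -> N) :
  (forall s, @sat _ n l E M f s) -> sat f s.
Proof. by move=> Mf; exact: generic_theory_complete. Qed.

(** With [edge_level] this makes [N] infinite: neighbours of one point at different levels [k] are
    distinct. *)
Lemma edge_total k (x : N) : exists y, edge (ord0, c0, k) x y.
Proof.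
have : @sat _ n l E N (Ex i1 (edge_formula E (ord0, c0, k) i0 i1)) (fun=> x).
  apply: transfer => s.
  have [|//|y yP] := @realize_labels l (fun=> s i0) (fun=> symbol_label (ord0, c0, k)).
    by [].
  exists y; apply/(sat_edge_generic E) => /=.
  have [ys ysk] := yP c0; split; first by move/esym.
  by rewrite vertex_labelC.
by case=> y /(sat_edge E) H; exists y.
Qed.

Lemma edge_level u c k k' (x y : N) :
  edge (u, c, k) x y -> edge (u, c, k') x y -> k = k'.
Proof.
move=> e e'; apply: contrapT => kk'.
pose f := Not (And (edge_formula E (u, c, k) i0 i1) (edge_formula E (u, c, k') i0 i1)).
have [] : sat f (assign x y y).
  apply: transfer => s [/(sat_edge_generic E)[_ L] /(sat_edge_generic E)[_]].
  by rewrite L => -[kk]; exact: kk'.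
by split; apply/(sat_edge E).
Qed.

(** In [M] constant blur forces equal levels, and then equal colours are forbidden; three variables
    express this. So the finitely many pairs [(u, c)] can serve as Ramsey colours, whatever the
    levels. *)
Lemma edge_triangle u c k k' k'' (x y z : N) :
  edge (u, c, k) x y -> edge (u, c, k') x z -> edge (u, c, k'') y z -> False.
Proof.
move=> exy exz eyz.
pose f := Not (And (edge_formula E (u, c, k) i0 i1)
  (And (edge_formula E (u, c, k') i0 i2) (edge_formula E (u, c, k'') i1 i2))).
have [] : sat f (assign x y z).
  apply: transfer => s [/(sat_edge_generic E)[s01 L1]].
  case=> /(sat_edge_generic E)[s02 L2] /(sat_edge_generic E)[s12 L3].
  have := vertex_label_compatible s01 s02 s12; rewrite L1 L2 L3.
  by case=> // -[<-] [<-] /(_ erefl erefl).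
by split; [|split]; apply/(sat_edge E).
Qed.

(** An atom decides every formula in [M] and holds there only at standard tuples, so it implies an
    equality or an edge formula; the implication transfers to [N]. *)
Lemma atom_edge :
  (forall s : 'I_n -> N, exists f, atom (tl_class generic_theory f) /\ sat f s) ->
  forall x y : N, x <> y -> exists r, edge r x y.
Proof.
move=> Nat x y xy; have [f [fat fs]] := Nat (assign x y y).
have imp g : (forall s, @sat _ n l E M f s -> @sat _ n l E M g s) ->
    sat g (assign x y y).
  move=> fg; apply: contrapT => ng.
  have [] : sat (Not (And f (Not g))) (assign x y y); last by [].
  by apply: transfer => s [/fg].
have [[s sf] fc] := (atomP model_generic_theory generic_theory_complete f).1 fat.
have st := atom_standard n_gt0 n_le_l model_generic_theory generic_theory_complete
  fat sf.
have [s01|s01] := pselect (s i0 = s i1).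
  case: xy; apply: (imp (Eq E i0 i1)) => t ft.
  exact: (fc (Eq E i0 i1) s t sf ft).
have := st _ _ s01; case E2: (vertex_label (s i0) (s i1)).2 => [[k c]|] // _.
pose r : edge_sig l := ((vertex_label (s i0) (s i1)).1, c, k); exists r.
apply/(sat_edge E (N := N) (r := r) (i := i0) (j := i1) (s := assign x y y)).
apply: imp => t ft.
apply: (fc _ s t sf ft); apply/(sat_edge_generic E); split=> //.
by rewrite /symbol_label /= -E2; case: vertex_label.
Qed.

Lemma exists_nonatomic_tuple :
  exists s : 'I_n -> N, forall f, atom (tl_class generic_theory f) -> ~ sat f s.
Proof.
apply: contrapT => /forallNP none.
have col (x y : N) : exists r : edge_sig l, x <> y -> edge r x y.
  have [xy|xy] := pselect (x = y); first by exists (ord0, c0, 0).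
  have [|r xyr] := atom_edge _ xy; last by exists r.
  move=> s; have /existsNP[f /not_implyP[fat /contrapT fs]] := none s.
  by exists f.
have [chi chiP] := choice (fun p : N * N => col p.1 p.2).
have [x0] := domain_inhabited N.
have [y yP] := choice (fun k => edge_total k x0).
have y_inj : injective y.
  by move=> k k' E'; apply: edge_level (yP k) _; rewrite E'.
(* The colouring forgets the level and keeps blur and colour, which range over a finite type. *)
have [|x [x1 [x2 [x01 x02 x12 e1 e2]]]] :=
    @mono_triangle _ N (fun x y => (chi (x, y)).1) (range y).
  rewrite (eq_finite_set (B := [set: nat]%classic)) //.
    exact: infinite_nat.
  by apply: inj_card_eq => k k' _ _; exact: y_inj.
have := chiP (x1, x2) x12; have := chiP (x, x2) x02; have := chiP (x, x1) x01.
move: e1 e2; case: (chi (x, x1)) (chi (x, x2)) (chi (x1, x2))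
  => [[u c] k] [uc k'] [uc' k''] /=.
by move=> -> ->; exact: edge_triangle.
Qed.

End NonAtomic.
End Main.

Theorem theorem3p16 (n l : nat) (n_gt2 : 2 < n) (n_le_l : n <= l) :
  exists S : signature,
    countable [set: symbol S] /\ (forall r : symbol S, arity r <= n) /\
    forall E : extension S n l,
    exists T : set (formula E),
      is_theory T /\ countable T /\ complete_theory T /\ atomic_theory T /\
      ~ (exists M : structure S, atomic_model T M) /\
      (forall M : structure S, model M T -> realizes M (coatom_type T)).
Proof.
have n_gt0 : 0 < n by apply: ltn_trans n_gt2.
exists (edge_sig l); split; first exact: (@countableP ('I_l.*2.+1 * 'I_l * nat)%type).
split=> [r|E]; first exact: ltnW.
exists (@generic_theory n l E); split; first by move=> f [].
split; first exact: countable_generic_theory.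
have mT := @model_generic_theory n l E.
have cT := @generic_theory_complete n l E.
split; first exact: complete_T mT cT.
split; first by move=> x; exact: (atomic_T n_gt0 n_le_l mT cT).
split=> [[N [NT Nat]]|N NT].
  have [s sN] := exists_nonatomic_tuple n_gt2 n_le_l NT.
  by have [f [/sN]] := Nat s.
have [s sN] := exists_nonatomic_tuple n_gt2 n_le_l NT.
(* The complement of a coatom is an atom, so a tuple that fails every atom satisfies every
   coatom. *)
exists s => f /compl_coatom; rewrite /Order.compl /= tl_notE => /sN.
exact: contrapT.
Qed.
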